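(* For the family of swap dynamics $\mathcal{M}_2$, the price of dynamics $\mathit{PoD}_{ark}(\mathcal{M}_2)$ with respect to the average rank is $2$ in the single-peaked domain.
   Context: Housing market: an instance is $I=\langle \mathcal{N},\mathcal{R},L,\pi^0\rangle$ with $\mathcal{N}=\{a_1,\dots,a_n\}$ a set of $n$ agents, $\mathcal{R}=\{r_1,\dots,r_n\}$ a set of $n$ resources, $L$ a profile of strict linear orders $\succ_i$ over $\mathcal{R}$, one for each agent $a_i$, and $\pi^0$ an initial allocation; an allocation $\pi$ is a bijective assignment of one resource $\pi_{a_i}$ to each agent $a_i$. The instance is single-peaked if there is a linear order $\lhd$ over $\mathcal{R}$ such that for every agent $a_i$ with top resource $t_i$ and all resources $r,r'$, if $r'\lhd r\lhd t_i$ or $t_i\lhd r\lhd r'$ then $r\succ_i r'$. Ranks: $rank_{a_i}(r)\in\{1,\dots,n\}$ is such that $a_i$'s most preferred resource has rank $n$, the second most preferred $n-1$, ..., the least preferred $1$. The average rank is $ark(\pi)=\frac1n\sum_{a_i\in\mathcal{N}}rank_{a_i}(\pi_{a_i})$. Swap dynamics: a swap-deal between two distinct agents exchanges the resources they currently hold; it is improving if both strictly prefer the resource they receive. A swap dynamics is determined by a selection heuristic, which at each round proposes a swap-deal (a pair of agents), possibly depending on the history and on the preferences, possibly randomly. Starting from $\pi^0$, the proposed deal is implemented (successful) if it is improving and refused otherwise. The heuristic has full coverage if for any two agents $a_x,a_y$ the deal $\langle a_x,a_y\rangle$ is proposed at some round, and, if there are successful swap-deals involving $a_x$ or $a_y$,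 at some round after the latest one. The process terminates when every pair $a_x,a_y$ has been unsuccessfully proposed at a round after which no successful deal involved $a_x$ or $a_y$; thus the final allocation is reached from $\pi^0$ by improving swap-deals and admits no improving swap-deal. $\mathcal{M}_2$ is the family of all swap dynamics whose selection heuristic has full coverage. $M(I)$ is the set of allocations that $M$ may return on $I$. Price of dynamics of a family $\mathcal{M}$ (the worst-case ratio between the best and the worst stable outcome obtainable by procedures of the family): $\mathit{PoD}_{v}(\mathcal{M})=\max_{I,\;M,M'\in\mathcal{M}}\dfrac{\max_{\pi\in M'(I)}v(\pi)}{\min_{\pi\in M(I)}v(\pi)}$, here with $v=ark$ and $\mathcal{M}=\mathcal{M}_2$, where $I$ ranges over the instances of the domain considered (here, the single-peaked instances). *)

(* Defs.v *)
From HB Require Import structures.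
From mathcomp Require Import all_boot all_order all_algebra all_fingroup.
From mathcomp Require Import mathcomp_extra boolp classical_sets reals ereal.
From mathcomp Require Import measure.

Set Implicit Arguments.
Unset Strict Implicit.
Unset Printing Implicit Defensive.

Import Order.TTheory GRing.Theory Num.Theory.

Local Open Scope classical_set_scope.
Local Open Scope ring_scope.

Definition strict_linear_order (T : eqType) (r : rel T) : Prop :=
  [/\ irreflexive r, transitive r & forall x y, x != y -> r x y || r y x].

(* Agents and resources are both labelled by 'I_n. [prefers a r r'] reads
   "agent a strictly prefers r to r'". An allocation is a permutation that
   maps each agent to the resource it holds. *)
Record market (n : nat) := Market {
  market_gt0 : (0 < n)%N;
  prefers : 'I_n -> rel 'I_n;
  prefers_linear : forall a, strict_linear_order (prefers a);
  initial : {perm 'I_n} }.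

Definition is_top (n : nat) (I : market n) (a t : 'I_n) : Prop :=
  forall r, r != t -> prefers I a t r.

Definition single_peaked (n : nat) (I : market n) : Prop :=
  exists2 lo : rel 'I_n, strict_linear_order lo &
    forall a t r r', is_top I a t ->
      (lo r' r /\ lo r t) \/ (lo t r /\ lo r r') -> prefers I a r r'.

(* The favourite resource has rank n and the least preferred one rank 1. *)
Definition rank (n : nat) (I : market n) (a r : 'I_n) : nat :=
  #|[pred r' | prefers I a r r']|.+1.

Definition ark (R : realType) (n : nat) (I : market n) (pi : {perm 'I_n}) : R :=
  (\sum_(a < n) rank I a (pi a))%N%:R / n%:R.

Section Process.
Variables (n : nat) (I : market n).
Implicit Types (pi : {perm 'I_n}) (d : 'I_n * 'I_n).

Definition improving pi d : bool :=
  prefers I d.1 (pi d.2) (pi d.1) && prefers I d.2 (pi d.1) (pi d.2).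

(* Permutations compose from left to right: a |-> pi (tperm d.1 d.2 a). *)
Definition swap pi d : {perm 'I_n} := (tperm d.1 d.2 * pi)%g.

(* A deal is an unordered pair of agents. *)
Definition is_deal (x y : 'I_n) d : bool := (d == (x, y)) || (d == (y, x)).

Definition involves d (x : 'I_n) : bool := (x == d.1) || (x == d.2).

(* Past proposals, oldest first; the boolean tells whether the deal was
   successful. *)
Definition history := seq (('I_n * 'I_n) * bool).

Definition terminated (h : history) : Prop :=
  forall x y : 'I_n, x != y -> exists (d : 'I_n * 'I_n) (h1 h2 : history),
    [/\ h = h1 ++ (d, false) :: h2, is_deal x y d &
        forall e, e \in h2 -> e.2 -> ~~ (involves e.1 x || involves e.1 y)].

Variable choice : history -> 'I_n * 'I_n.

Definition next (s : {perm 'I_n} * history) : {perm 'I_n} * history :=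
  let d := choice s.2 in
  let b := improving s.1 d in
  (if b then swap s.1 d else s.1, rcons s.2 (d, b)).

(* Rounds are numbered from 0; [alloc_at k] and [history_at k] describe the
   situation just before round k. *)
Definition state_at (k : nat) : {perm 'I_n} * history :=
  iter k next (initial I, [::]).
Definition alloc_at (k : nat) : {perm 'I_n} := (state_at k).1.
Definition history_at (k : nat) : history := (state_at k).2.
Definition proposal_at (k : nat) : 'I_n * 'I_n := choice (history_at k).
Definition success_at (k : nat) : bool := improving (alloc_at k) (proposal_at k).

Definition covers : Prop :=
  forall x y : 'I_n, x != y -> exists2 k, is_deal x y (proposal_at k) &
    forall j, success_at j ->
      involves (proposal_at j) x || involves (proposal_at j) y -> (j < k)%N.

Definition returns pi : Prop :=
  exists2 k, terminated (history_at k) & pi = alloc_at k.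

End Process.

(* A randomized heuristic is a heuristic that also reads a random seed, drawn
   once for the whole run from an arbitrary probability space; the history of
   the run includes the initial allocation, hence the dependence on the market.
   What is proposed after termination is irrelevant: a market with a single
   agent, in which there is no deal to propose, terminates at once. *)
Record swap_dynamics (R : realType) := SwapDynamics {
  seed_display : measure_display;
  seed : measurableType seed_display;
  seed_law : probability seed R;
  propose : seed -> forall n, market n -> history n -> 'I_n * 'I_n;
  propose_measurable : forall n (I : market n) h d,
    measurable [set w | propose w I h = d];
  propose_distinct : forall w n (I : market n) h, ~ terminated h ->
    (propose w I h).1 != (propose w I h).2 }.

Definition full_coverage (R : realType) (M : swap_dynamics R) : Prop :=
  forall n (I : market n), {ae seed_law M, forall w, covers I (propose w I)}.

Definition outcomes (R : realType) (M : swap_dynamics R) (n : nat)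
    (I : market n) : set {perm 'I_n} :=
  [set pi | (0 < seed_law M [set w | returns I (propose w I) pi])%E].

(* For dynamics with full coverage [outcomes] is finite and nonempty, so sup
   and inf below are a maximum and a minimum. Over all markets, of all sizes,
   the worst-case ratio is a supremum that need not be attained. *)
Definition price_of_dynamics (R : realType)
    (domain : forall n, market n -> Prop)
    (v : forall n, market n -> {perm 'I_n} -> R)
    (family : swap_dynamics R -> Prop) : \bar R :=
  ereal_sup [set q | exists n (I : market n) (M M' : swap_dynamics R),
    [/\ domain n I, family M, family M' &
        q = (sup [set v n I pi | pi in outcomes M' I] /
             inf [set v n I pi | pi in outcomes M I])%:E]].

(* Main.v *)
Require Import Defs.
From mathcomp Require Import all_boot all_order all_algebra.
From mathcomp Require Import reals ereal.
From mathcomp Require Import all_fingroup boolp classical_sets measure zify lra.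

(** In a stable allocation, of any two agents at least one does not envy the
    other. Counting the pairs (a, b) such that a does not envy b gives total
    rank at least n (n + 1) / 2, hence average rank at least (n + 1) / 2, while
    no average rank exceeds n: all ratios are below 2, on every domain.

    Conversely, take agents and resources 0, ..., N, with agent k holding k.
    For 0 < k < N, agent k ranks k-1 > ... > 0 > k > ... > N; agent 0 ranks
    N > ... > 0 and agent N ranks 0 > ... > N. If 0 and N trade first, both get
    their favourite, and each remaining agent k is stuck with rank N + 1 - k:
    its k favourites 0, ..., k-1 are held by agents that do not want k. If agent 0
    trades successively with 1, 2, ..., N, everybody but N ends up with its
    favourite. The total ranks (N+1)^2 - N(N-1)/2 and (N+1)^2 - (N-1) have a
    ratio that tends to 2. *)

Set Implicit Arguments.
Unset Strict Implicit.
Unset Printing Implicit Defensive.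

Import Order.TTheory GRing.Theory Num.Theory.

(** * Ranks, stability and the effect of a swap *)

Definition stable n (I : market n) (pi : {perm 'I_n}) : Prop :=
  forall d, ~~ improving I pi d.

Definition total_rank n (I : market n) (pi : {perm 'I_n}) : nat :=
  \sum_(a < n) rank I a (pi a).

Section Preferences.
Variables (n : nat) (I : market n).
Implicit Types (pi : {perm 'I_n}) (a r : 'I_n).

Lemma prefers_irr a r : prefers I a r r = false.
Proof. by case: (prefers_linear I a). Qed.

Lemma prefers_trans a : transitive (prefers I a).
Proof. by case: (prefers_linear I a). Qed.

Lemma prefers_total a r r' : r != r' -> prefers I a r r' || prefers I a r' r.
Proof. by case: (prefers_linear I a) => _ _; apply. Qed.

Lemma rank_le a r : rank I a r <= n.
Proof.
rewrite -[X in _ <= X]card_ord /rank; apply: proper_card.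
apply/fintype.properP; split; first by apply/fintype.subsetP.
by exists r; rewrite // inE prefers_irr.
Qed.

Lemma ltn_rank a r r' : prefers I a r r' -> rank I a r' < rank I a r.
Proof.
move=> arr'; rewrite ltnS; apply: proper_card; apply/fintype.properP; split.
  by apply/fintype.subsetP => x; rewrite !inE; apply: prefers_trans.
by exists r'; rewrite !inE ?prefers_irr.
Qed.

Lemma total_rank_le pi : total_rank I pi <= n * n.
Proof.
rewrite -[in X in _ <= X * _](card_ord n) -sum_nat_const.
by apply: leq_sum => a _; apply: rank_le.
Qed.

Lemma stable_total_rank pi : stable I pi -> n * n.+1 <= (total_rank I pi).*2.
Proof.
move=> st; pose P a b : nat := prefers I a (pi a) (pi b).
have -> : total_rank I pi = \sum_a \sum_b P a b + n.
  transitivity (\sum_(a < n) (\sum_b P a b + 1)); last first.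
    by rewrite big_split /= sum1_card card_ord.
  apply: eq_bigr => a _; rewrite addn1 /rank -sum1_card big_mkcond /=.
  congr _.+1; rewrite (reindex_inj (@perm_inj _ pi)).
  by apply: eq_bigr => b _; rewrite inE /P; case: prefers.
suff: n * n <= (\sum_a \sum_b P a b).*2 + n by lia.
(* Symmetrizing reduces the bound to one row at a time: for fixed [a], stability gives
   [P a b + P b a >= 1] whenever [b != a], and the unit taken from the summand [n] pays for the
   diagonal. *)
rewrite -addnn {2}exchange_big -big_split /=.
rewrite -[X in _ + X](card_ord n) -sum1_card -big_split /=.
rewrite -[X in X * _ <= _](card_ord n) -sum_nat_const; apply: leq_sum => a _.
rewrite -big_split /= (bigD1 a) //= addnAC -[n in n <= _]card_ord.
rewrite -sum1_card (bigD1 a) //=; apply: leq_add; first by rewrite leq_addl.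
apply: leq_sum => b ba; have := st (a, b); rewrite /improving /= negb_and /P.
have ab : pi a != pi b by rewrite (inj_eq perm_inj) eq_sym.
have := prefers_total a ab; have := prefers_total b ab.
by do 4 case: (prefers _ _ _ _).
Qed.

Lemma swapE pi d a : swap pi d a = pi (tperm d.1 d.2 a).
Proof. by rewrite permM. Qed.

Lemma swap_id pi d a : ~~ involves d a -> swap pi d a = pi a.
Proof.
rewrite negb_or => /andP[a1 a2].
by rewrite swapE tpermD // eq_sym.
Qed.

(** Only the two traders change resources, and both gain. This makes the total rank a potential for
    the dynamics. *)
Lemma improving_total_rank pi d :
  improving I pi d -> total_rank I pi < total_rank I (swap pi d).
Proof.
case: d => x y; rewrite /improving /= => /andP[px py].
have xy : y != x by apply: contraTneq px => ->; rewrite prefers_irr.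
have split_xy (F : 'I_n -> nat) :
    \sum_a F a = F x + (F y + \sum_(a | (a != x) && (a != y)) F a).
  by rewrite (bigD1 x) //= (bigD1 y).
rewrite /total_rank !split_xy !swapE /= tpermL tpermR.
rewrite [X in _ < _ + (_ + X)](eq_bigr (fun a => rank I a (pi a))); last first.
  by move=> a /andP[ax ay]; rewrite swap_id //= /involves negb_or ax ay.
by rewrite !addnA ltn_add2r -addSn leq_add // ?ltn_rank // ltnW ?ltn_rank.
Qed.

End Preferences.

(** * Runs of a heuristic: stability, termination and coverage *)

Section Runs.
Variables (n : nat) (I : market n) (choice : history n -> 'I_n * 'I_n).
Local Notation alloc k := (alloc_at I choice k).
Local Notation hist k := (history_at I choice k).
Local Notation deal k := (proposal_at I choice k).
Local Notation success k := (success_at I choice k).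

Lemma alloc_atS k :
  alloc k.+1 = if success k then swap (alloc k) (deal k) else alloc k.
Proof. by []. Qed.

Lemma history_atE k :
  hist k = [seq (deal j, success j) | j <- iota 0 k].
Proof.
elim: k => [//|k IHk]; rewrite -[k.+1 in RHS]addn1 iotaD map_cat -IHk cats1.
by [].
Qed.

Lemma size_history_at k : size (hist k) = k.
Proof. by rewrite history_atE size_map size_iota. Qed.

Lemma alloc_at_unchanged x j k : j <= k ->
  (forall i, j <= i < k -> success i -> ~~ involves (deal i) x) ->
  alloc k x = alloc j x.
Proof.
move=> jk; rewrite -(subnKC jk); elim: (k - j) => [|m IHm] H; first by rewrite addn0.
rewrite addnS alloc_atS -IHm => [|i ij]; last by apply: H; lia.
case: ifP => // s; apply: swap_id; apply: H => //; lia.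
Qed.

Lemma is_deal_involves x y (d : 'I_n * 'I_n) :
  is_deal x y d -> involves d x && involves d y.
Proof. by case/orP => /eqP ->; rewrite /involves !eqxx ?orbT. Qed.

Lemma improving_is_deal (pi : {perm 'I_n}) x y d :
  is_deal x y d -> improving I pi d = improving I pi (x, y).
Proof. by case/orP => /eqP -> //; rewrite /improving andbC. Qed.

(** The final history records a refusal for each pair, after which neither agent trades; both still
    hold what they held then, so the deal is still not improving. *)
Lemma returns_stable pi : returns I choice pi -> stable I pi.
Proof.
case=> k term -> [x y]; case: (eqVneq x y) => [-> | xy].
  by rewrite /improving /= prefers_irr.
have [d [h1 [h2 [hE dxy H]]]] := term x y xy.
pose j := size h1.
have jk : j < k.
  by rewrite -(size_history_at k) hE size_cat /= -addSnnS leq_addr.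
have nthE i : i < k -> nth (d, false) (hist k) i = (deal i, success i).
  by move=> ik; rewrite history_atE (nth_map 0) ?size_iota // nth_iota.
have [dj sj] : d = deal j /\ false = success j.
  by have := nthE j jk; rewrite hE nth_cat ltnn subnn => -[].
(* Round [j] belongs to the range because [alloc j] is the situation before it; its deal is the
   refused one, hence not a success. *)
have later i : j <= i < k -> success i -> ~~ (involves (deal i) x || involves (deal i) y).
  rewrite leq_eqVlt => /andP[/orP[/eqP <- _|ji ik]]; first by rewrite -sj.
  apply: (H (deal i, success i)).
  have -> : (deal i, success i) = nth (d, false) h2 (i - j.+1).
    rewrite -nthE // hE nth_cat ltnNge ltnW //= -/j.
    by rewrite -[i - j]prednK ?subn_gt0 //= -subnS.
  apply: mem_nth; have := size_history_at k; rewrite hE size_cat /= -/j; lia.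
have unch z : z \in [:: x; y] -> alloc k z = alloc j z.
  move=> zxy; apply: alloc_at_unchanged; first exact: ltnW.
  move=> i ijk si; have := later i ijk si; rewrite negb_or => /andP[].
  by move: zxy; rewrite !inE => /orP[] /eqP ->.
move: sj; rewrite /success_at -dj (improving_is_deal _ dxy) /improving /=.
by rewrite !unch ?inE ?eqxx ?orbT // => <-.
Qed.

(** There are finitely many pairs, so their covering rounds, chosen by [f], have a maximum; past it
    every pair has its final refusal. *)
Lemma covers_terminated : covers I choice ->
  exists K, forall k, K <= k -> terminated (hist k).
Proof.
move=> cov.
have [f Hf] : exists f : 'I_n * 'I_n -> nat, forall p, p.1 != p.2 ->
    is_deal p.1 p.2 (deal (f p)) /\ forall j, success j ->
      involves (deal j) p.1 || involves (deal j) p.2 -> j < f p.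
  apply: (@fin_all_exists _ (fun=> nat) (fun p m => p.1 != p.2 ->
    is_deal p.1 p.2 (deal m) /\ forall j, success j ->
      involves (deal j) p.1 || involves (deal j) p.2 -> j < m)) => p.
  case: (boolP (p.1 != p.2)) => [/cov[m dm Hm]|_]; last by exists 0.
  by exists m.
exists (\max_p (f p)).+1 => k Kk x y xy.
have [dm Hm] := Hf (x, y) xy; set m := f (x, y) in dm Hm.
have mk : m < k by apply: leq_ltn_trans Kk; apply: leq_bigmax.
(* A success at round [m] would involve [x], and coverage would then give [m < m]. *)
have sm : success m = false.
  apply/negP => sm; have /andP[mx _] := is_deal_involves dm.
  by have := Hm m sm; rewrite mx ltnn => /(_ isT).
exists (deal m), (hist m), [seq (deal j, success j) | j <- iota m.+1 (k - m.+1)].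
split=> //.
  have iotaE : iota 0 k = iota 0 m ++ m :: iota m.+1 (k - m.+1).
    by rewrite -{1}(subnKC mk) addSnnS iotaD.
  by rewrite -sm !history_atE iotaE map_cat.
move=> e /mapP[j]; rewrite mem_iota => /andP[mj _] -> /= sj.
by apply/negP => /(Hm j sj); rewrite ltnNge ltnW.
Qed.

(** The total rank never decreases, grows at each success and is at most [n * n]; [T] is a round at
    which it is maximal. *)
Lemma finitely_many_successes : exists T, forall j, T <= j -> ~~ success j.
Proof.
pose v k := total_rank I (alloc k).
have vS k : v k + success k <= v k.+1.
  rewrite /v alloc_atS; case: ifP => [s|_]; last by rewrite addn0.
  by rewrite addn1; apply: improving_total_rank.
have vmon j k : j <= k -> v j <= v k.
  move/subnKC <-; elim: (k - j) => [|m IHm]; first by rewrite addn0.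
  by rewrite addnS; have := vS (j + m); lia.
pose P m := `[< exists k, v k = m >].
have exP : exists m, P m by exists (v 0); apply/asboolP; exists 0.
have ubP m : P m -> m <= n * n by move=> /asboolP[k <-]; apply: total_rank_le.
case: (ex_maxnP exP ubP) => m /asboolP[T vT] maxm.
exists T => j Tj; have := maxm (v j.+1); have := vS j; have := vmon _ _ Tj.
rewrite vT => h1 h2 h3.
have {}h3 : v j.+1 <= m by apply: h3; apply/asboolP; exists j.+1.
by case: (success j) h2 => // h2; lia.
Qed.

(** Successes eventually cease, so a pair proposed arbitrarily late is proposed after all of
    them. *)
Lemma frequent_covers :
  (forall x y, x != y -> forall T, exists2 k, T <= k & is_deal x y (deal k)) ->
  covers I choice.
Proof.
move=> freq x y xy; have [T HT] := finitely_many_successes.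
have [k Tk dk] := freq x y xy T; exists k => // j sj _.
by rewrite ltnNge; apply: contraL sj => kj; apply/HT/(leq_trans Tk).
Qed.

Lemma stable_alloc_final T k : stable I (alloc T) -> T <= k -> alloc k = alloc T.
Proof.
move=> st /subnKC <-; elim: (k - T) => [|m IHm]; first by rewrite addn0.
by rewrite addnS alloc_atS /success_at IHm (negbTE (st _)).
Qed.

Lemma covers_returns T :
  covers I choice -> stable I (alloc T) -> returns I choice (alloc T).
Proof.
move=> /covers_terminated[K HK] st; exists (maxn K T).
  by apply: HK; apply: leq_maxl.
by rewrite (stable_alloc_final st) // leq_maxr.
Qed.

End Runs.

(** * Cyclic enumeration of all pairs *)

Section RoundRobin.
Variables (n : nat) (n_gt0 : 0 < n) (c : nat).
Let ord i : 'I_n := Ordinal (ltn_pmod i n_gt0).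

(* Round [k] of a cyclic enumeration of all pairs; a diagonal pair, in
   particular the first one, is replaced by the deal between 0 and [c]. *)
Definition round_robin (k : nat) : 'I_n * 'I_n :=
  if ord (k %/ n) == ord k then (ord 0, ord c) else (ord (k %/ n), ord k).

Lemma round_robin_neq k : 0 < c < n -> (round_robin k).1 != (round_robin k).2.
Proof.
move=> /andP[c0 cn]; rewrite /round_robin; case: ifP => [_|-> //].
by rewrite -val_eqE /= mod0n modn_small // eq_sym -lt0n.
Qed.

Lemma round_robin0 : c < n -> (round_robin 0).1 = 0 :> nat /\ (round_robin 0).2 = c :> nat.
Proof.
by move=> cn; rewrite /round_robin div0n eqxx /= mod0n modn_small.
Qed.

Lemma round_robin_lt k : 0 < k < n ->
  (round_robin k).1 = 0 :> nat /\ (round_robin k).2 = k :> nat.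
Proof.
move=> /andP[k0 kn]; rewrite /round_robin -val_eqE /= divn_small // mod0n.
by rewrite modn_small // ltn_eqF //= mod0n modn_small.
Qed.

Lemma round_robin_frequent (x y : 'I_n) T : x != y ->
  exists2 k, T <= k & round_robin k = (x, y).
Proof.
(* In base [n], the last two digits of this round are [x] and [y]; the leading part [T] makes it
   late enough. *)
move=> xy; exists ((T * n + x) * n + y).
  by have := leq_pmulr T n_gt0; have := leq_pmulr (T * n + x) n_gt0; lia.
rewrite /round_robin; set k := _ + y.
have kx : ord (k %/ n) = x.
  apply: val_inj; rewrite /= /k divnMDl // (divn_small (ltn_ord y)) addn0.
  by rewrite modnMDl modn_small.
have ky : ord k = y by apply: val_inj; rewrite /= /k modnMDl modn_small.
by rewrite kx ky (negbTE xy).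
Qed.

End RoundRobin.

Lemma single_agent_terminated n (h : history n) : n <= 1 -> terminated h.
Proof.
move=> n1 x y /eqP[]; apply: val_inj => /=.
by have := ltn_ord x; have := ltn_ord y; lia.
Qed.

(** * Round robin as a deterministic dynamics with full coverage *)

Section RoundRobinDynamics.
Variables (R : realType) (c : nat -> nat).
Hypothesis c_bounds : forall n, 1 < n -> 0 < c n < n.

Definition round_robin_proposal (w : unit) n (I : market n) (h : history n) :=
  round_robin (market_gt0 I) (c n) (size h).

Lemma round_robin_proposal_measurable n (I : market n) h d :
  measurable [set w | round_robin_proposal w I h = d].
Proof. by []. Qed.

Lemma round_robin_proposal_distinct w n (I : market n) h : ~ terminated h ->
  (round_robin_proposal w I h).1 != (round_robin_proposal w I h).2.
Proof.
move=> unfinished; apply/round_robin_neq/c_bounds.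
by rewrite ltnNge; apply/negP => /(single_agent_terminated h).
Qed.

(** Two choices of [c] are used: [predn] makes the extreme agents trade first, the constant 1 starts
    the successive trades of agent 0. *)
Definition round_robin_dynamics : swap_dynamics R :=
  SwapDynamics (dirac tt : probability _ R) round_robin_proposal_measurable
    round_robin_proposal_distinct.

Lemma round_robin_proposal_at n (I : market n) w k :
  proposal_at I (round_robin_proposal w I) k = round_robin (market_gt0 I) (c n) k.
Proof. by rewrite /proposal_at /round_robin_proposal size_history_at. Qed.

Lemma round_robin_covers n (I : market n) w : covers I (round_robin_proposal w I).
Proof.
apply: frequent_covers => x y xy T.
have [k Tk kE] := round_robin_frequent (market_gt0 I) (c n) T xy.
by exists k => //; rewrite round_robin_proposal_at kE /is_deal eqxx.
Qed.

Lemma round_robin_full_coverage : full_coverage round_robin_dynamics.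
Proof. by move=> n I; apply: aeW => w; apply: round_robin_covers. Qed.

(** The seed space is a single point, so an allocation returned by this one run has probability
    1. *)
Lemma round_robin_outcome n (I : market n) k :
  stable I (alloc_at I (round_robin_proposal tt I) k) ->
  outcomes round_robin_dynamics I (alloc_at I (round_robin_proposal tt I) k).
Proof.
move=> st; rewrite /outcomes /=.
have -> : [set w | returns I (round_robin_proposal w I)
    (alloc_at I (round_robin_proposal tt I) k)]%classic = setT.
  apply/seteqP; split=> // -[] _ /=.
  by apply: covers_returns => //; apply: round_robin_covers.
by rewrite probability_setT lte01.
Qed.

End RoundRobinDynamics.

(** * The chain market *)

(* With [p := peak N a], agent [a] ranks p-1 > ... > 0 > p > ... > N, and
   [cost p r] is the number of resources that it prefers to [r]. *)
Definition peak (N a : nat) : nat :=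
  if a == 0 then N.+1 else if a == N then 0 else a.

Definition cost (p r : nat) : nat := if r < p then p.-1 - r else r.

Lemma peak_le N a : a <= N -> peak N a <= N.+1.
Proof. by rewrite /peak; do 2 case: ifP => //; lia. Qed.

Lemma cost_inj p r r' : cost p r = cost p r' -> r = r'.
Proof. by rewrite /cost; do 2 case: ifP; lia. Qed.

Lemma cost_lt N p r : p <= N.+1 -> r <= N -> cost p r < N.+1.
Proof. by rewrite /cost; case: ifP; lia. Qed.

(* Innermost conditions come first: [lia] ignores conditions that contain an
   undecided [if]. *)
Ltac cost_lia :=
  rewrite /cost /peak /=;
  repeat match goal with
  | |- context [if ?b then _ else _] =>
    lazymatch b with
    | context [if _ then _ else _] => fail
    | _ => case: (boolP b) => ?; try lia
    end
  end; try lia.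

Section ChainMarket.
Variable N : nat.

Definition chain_prefers (a r r' : 'I_N.+1) : bool :=
  cost (peak N a) r < cost (peak N a) r'.

Lemma chain_prefers_linear a : strict_linear_order (chain_prefers a).
Proof.
split=> [r | r s t | r s rs].
- by rewrite /chain_prefers ltnn.
- by apply: ltn_trans.
- rewrite /chain_prefers -neq_ltn; apply: contra rs => /eqP/cost_inj rs.
  by apply/eqP/val_inj.
Qed.

Definition chain_market : market N.+1 :=
  Market (ltn0Sn N) chain_prefers_linear 1%g.

(** For the natural order, [cost p] decreases up to [p - 1] and increases afterwards. The top
    resource is [p.-1], which truncation makes 0 for [p = 0]. *)
Lemma chain_single_peaked : single_peaked chain_market.
Proof.
exists (fun r s => r < s).
  split=> [r | r s t | r s rs]; [by rewrite /= ltnn | by apply: ltn_trans |].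
  by rewrite -neq_ltn.
move=> a t r r' top.
have tE : t = (peak N a).-1 :> nat.
  have pN : (peak N a).-1 < N.+1.
    by have := peak_le (ltn_ord a); have := ltn_ord a; rewrite ltnS => /peak_le; lia.
  case: (eqVneq (Ordinal pN) t) => [<- //| /top].
  by rewrite /= /chain_prefers; cost_lia.
by move: tE; rewrite /= /chain_prefers; cost_lia.
Qed.

(** The cost permutes 0, ..., N, so the resources worse than [r] correspond to the costs above that
    of [r]. *)
Lemma chain_rank (a r : 'I_N.+1) :
  rank chain_market a r + cost (peak N a) r = N.+1.
Proof.
have aN : peak N a <= N.+1 by apply: peak_le; rewrite -ltnS.
pose f (s : 'I_N.+1) : 'I_N.+1 := Ordinal (cost_lt aN (ltn_ord s : s <= N)).
have f_inj : injective f by move=> s t [] /cost_inj st; apply: val_inj.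
have -> : rank chain_market a r = (\sum_(s < N.+1 | f r < s) 1).+1.
  by rewrite (reindex_inj f_inj) /= sum1_card.
have -> : \sum_(s < N.+1 | f r < s) 1 = \sum_((f r).+1 <= i < N.+1) 1.
  by rewrite big_geq_mkord.
have frN : f r <= N by rewrite -ltnS.
by rewrite sum_nat_const_nat muln1 subSS addSn (subnK frN).
Qed.


Lemma chain_total_rank (pi : {perm 'I_N.+1}) :
  total_rank chain_market pi + \sum_(a < N.+1) cost (peak N a) (pi a) = N.+1 * N.+1.
Proof.
rewrite /total_rank -big_split /=.
rewrite (eq_bigr (fun=> N.+1)) => [|a _]; last exact: chain_rank.
by rewrite sum_nat_const card_ord.
Qed.

Lemma chain_improving (pi : {perm 'I_N.+1}) x y :
  improving chain_market pi (x, y) =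
    (cost (peak N x) (pi y) < cost (peak N x) (pi x)) &&
    (cost (peak N y) (pi x) < cost (peak N y) (pi y)).
Proof. by []. Qed.

End ChainMarket.

(** * The bad and the good run on the chain market *)

Section ChainRuns.
Variables (N : nat) (c : nat -> nat).
Let I := chain_market N.
Local Notation alloc k := (alloc_at I (round_robin_proposal c tt I) k).

Lemma chain_alloc1 (a : 'I_N.+1) : 0 < c N.+1 <= N ->
  alloc 1 a = (if a == 0 :> nat then c N.+1 else if a == c N.+1 :> nat then 0 else a) :> nat.
Proof.
move=> cN; have cn : c N.+1 < N.+1 by lia.
have [d1 d2] := round_robin0 (market_gt0 I) cn.
rewrite alloc_atS /success_at round_robin_proposal_at.
case: (round_robin _ _ 0) d1 d2 => x y /= x0 yc.
rewrite chain_improving !perm1 x0 yc ifT; last first.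
  by cost_lia.
rewrite swapE /=; case: tpermP => [->|->|/eqP ax /eqP ay]; rewrite perm1.
- by rewrite x0 yc eqxx.
- rewrite x0 yc eqxx; case: ifP; lia.
- by move: ax ay; rewrite -!val_eqE /= x0 yc => /negbTE -> /negbTE ->.
Qed.

End ChainRuns.

Lemma chain_bad_alloc N (a : 'I_N.+1) : 0 < N ->
  let I := chain_market N in
  alloc_at I (round_robin_proposal predn tt I) 1 a =
    (if a == 0 :> nat then N else if a == N :> nat then 0 else a) :> nat.
Proof. by move=> N0; rewrite /= chain_alloc1 //= N0 leqnn. Qed.

(** Holding [k], agent 0 wants [k + 1], whose owner, agent [k + 1], prefers [k]: each next trade
    succeeds. *)
Lemma chain_good_alloc N (k : nat) (a : 'I_N.+1) : 0 < k <= N ->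
  let I := chain_market N in
  alloc_at I (round_robin_proposal (fun=> 1) tt I) k.+1 a =
    (if a == 0 :> nat then k else if a <= k then a.-1 else a) :> nat.
Proof.
move=> kN I; elim: k kN a => [//|k IHk] kN a.
rewrite alloc_atS /success_at round_robin_proposal_at.
have [d1 d2] := round_robin_lt (market_gt0 I) 1 (kN : 0 < k.+1 < N.+1).
case: (round_robin _ _ _) d1 d2 => x y /= x0 yk.
rewrite chain_improving; case: (posnP k) => [k0|k_gt0].
  (* Since [c] is 1, round 1 repeats the deal of round 0 and is refused. *)
  have N0 : 0 < 1 <= N by lia.
  rewrite k0 !chain_alloc1 // x0 yk k0 /= ifF; last by cost_lia.
  by rewrite chain_alloc1 //=; cost_lia.
have {}IHk b := IHk ltac:(lia) b.
rewrite !IHk x0 yk /= ltnn ifT; last first.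
  by cost_lia.
rewrite swapE /=; case: tpermP => [->|->|/eqP ax /eqP ay]; rewrite IHk.
- by rewrite x0 yk /= ltnn.
- by rewrite yk x0 /= leqnn.
- by move: ax ay; rewrite -!val_eqE /= x0 yk; cost_lia.
Qed.

Lemma chain_bad_stable N : 0 < N ->
  let I := chain_market N in
  stable I (alloc_at I (round_robin_proposal predn tt I) 1).
Proof.
move=> N0 I [x y]; have := ltn_ord x; have := ltn_ord y.
rewrite chain_improving !chain_bad_alloc //; cost_lia.
Qed.

(** Of two distinct agents, one is not [N], hence already holds its favourite. *)
Lemma chain_good_stable N : 0 < N ->
  let I := chain_market N in
  stable I (alloc_at I (round_robin_proposal (fun=> 1) tt I) N.+1).
Proof.
move=> N0 I [x y]; have := ltn_ord x; have := ltn_ord y.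
rewrite chain_improving !chain_good_alloc ?N0 ?leqnn //; cost_lia.
Qed.

(** Agents 0 and [N] have cost 0 and every other agent [k] has cost [k]; doubling avoids halving
    [N * N.-1]. *)
Lemma chain_bad_total N : 0 < N ->
  let I := chain_market N in
  (total_rank I (alloc_at I (round_robin_proposal predn tt I) 1)).*2 + N * N.-1
    = (N.+1 * N.+1).*2.
Proof.
move=> N0 I; have <- := chain_total_rank (alloc_at I (round_robin_proposal predn tt I) 1).
rewrite doubleD; congr (_ + _).
have -> : \sum_(a < N.+1) cost (peak N a) (alloc_at I (round_robin_proposal predn tt I) 1 a)
    = \sum_(a < N.+1) (if a < N then val a else 0).
  apply: eq_bigr => a _; rewrite chain_bad_alloc //; have := ltn_ord a.
  by cost_lia.
rewrite big_ord_recr /= ltnn addn0 (eq_bigr (fun a : 'I_N => val a)) => [|a _].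
  by rewrite -(big_mkord predT id) bin2_sum -[in LHS](bin1 N.-1) mul_bin_diag mul2n.
by rewrite ltn_ord.
Qed.

(** The only loss is that of agent [N], which holds [N - 1] at cost [N - 1]. *)
Lemma chain_good_total N : 0 < N ->
  let I := chain_market N in
  total_rank I (alloc_at I (round_robin_proposal (fun=> 1) tt I) N.+1) + N.-1
    = N.+1 * N.+1.
Proof.
move=> N0 I.
have <- := chain_total_rank (alloc_at I (round_robin_proposal (fun=> 1) tt I) N.+1).
congr (_ + _); rewrite big_ord_recr big1 /= => [|a _].
  by rewrite chain_good_alloc ?N0 ?leqnn //=; cost_lia.
rewrite chain_good_alloc ?N0 ?leqnn //=; have := ltn_ord a.
by cost_lia.
Qed.

Local Open Scope ring_scope.

(** * Bounds on the ratio of average ranks *)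

Section Price.
Variable R : realType.

Section Bounds.
Variables (n : nat) (I : market n).

Lemma market_size_gt0 : (0 : R) < n%:R.
Proof. by rewrite ltr0n (market_gt0 I). Qed.

Lemma arkE pi : ark R I pi = (total_rank I pi)%:R / n%:R.
Proof. by []. Qed.

Lemma ark_le pi : ark R I pi <= n%:R.
Proof.
by rewrite arkE ler_pdivrMr ?market_size_gt0 // -natrM ler_nat total_rank_le.
Qed.

Lemma ark_ge0 pi : 0 <= ark R I pi.
Proof. by rewrite arkE divr_ge0 ?ler0n. Qed.

Lemma stable_ark pi : stable I pi -> n%:R <= ark R I pi * 2.
Proof.
move=> /stable_total_rank st; rewrite arkE mulrAC ler_pdivlMr ?market_size_gt0 //.
by rewrite -!natrM ler_nat; lia.
Qed.

Section Outcomes.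
Variable M : swap_dynamics R.

(** An event of positive probability contains a seed, and one run that returns [pi] suffices. *)
Lemma outcome_stable pi : outcomes M I pi -> stable I pi.
Proof.
rewrite /outcomes /= => pos.
suff [w /returns_stable //] : ([set w : seed M | returns I (propose w I) pi] !=set0)%classic.
by apply/set0P; apply: contraTneq pos => ->; rewrite measure0 ltxx.
Qed.

Lemma ark_sup_le : sup [set ark R I pi | pi in outcomes M I]%classic <= n%:R.
Proof.
have [->|/set0P ne] := eqVneq [set ark R I pi | pi in outcomes M I]%classic set0.
  by rewrite sup0 ler0n.
by apply: ge_sup => // _ [pi _ <-]; apply: ark_le.
Qed.

Lemma ark_le_sup pi : outcomes M I pi ->
  ark R I pi <= sup [set ark R I pi | pi in outcomes M I]%classic.
Proof.
move=> Mpi; apply: ub_le_sup; last by exists pi.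
by exists n%:R => _ [? _ <-]; apply: ark_le.
Qed.

Lemma ark_inf_le pi : outcomes M I pi ->
  inf [set ark R I pi | pi in outcomes M I]%classic <= ark R I pi.
Proof.
move=> Mpi; apply: ge_inf; last by exists pi.
by exists 0 => _ [? _ <-]; apply: ark_ge0.
Qed.

Lemma ark_inf_ge : (outcomes M I !=set0)%classic ->
  n%:R <= inf [set ark R I pi | pi in outcomes M I]%classic * 2.
Proof.
move=> [pi Mpi]; rewrite -ler_pdivrMr //; apply: lb_le_inf.
  by exists (ark R I pi), pi.
by move=> _ [rho /outcome_stable st <-]; rewrite ler_pdivrMr // stable_ark.
Qed.

End Outcomes.

Lemma ark_ratio_le (M M' : swap_dynamics R) :
  sup [set ark R I pi | pi in outcomes M' I]%classic /
  inf [set ark R I pi | pi in outcomes M I]%classic <= 2.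
Proof.
(* If there is no outcome, the infimum is 0 by convention, and so is the quotient by it. *)
have [M0|/set0P ne] := eqVneq (outcomes M I) set0.
  by rewrite M0 image_set0 inf0 invr0 mulr0.
have infn := ark_inf_ge ne; have n0 := market_size_gt0.
rewrite ler_pdivrMr; last lra.
by rewrite mulrC; apply: le_trans infn; apply: ark_sup_le.
Qed.

End Bounds.

Lemma chain_ratio_ge (N : nat) (e : R) (M M' : swap_dynamics R) :
  let I := chain_market N in (0 < N)%N -> 8 <= e * N%:R ->
  outcomes M I (alloc_at I (round_robin_proposal predn tt I) 1) ->
  outcomes M' I (alloc_at I (round_robin_proposal (fun=> 1%N) tt I) N.+1) ->
  2 - e <= sup [set ark R I pi | pi in outcomes M' I]%classic /
           inf [set ark R I pi | pi in outcomes M I]%classic.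
Proof.
move=> I N0 eN Mbad Mgood.
have /ark_inf_ge infn : (outcomes M I !=set0)%classic by eexists; apply: Mbad.
have n0 := market_size_gt0 I.
have := ark_inf_le Mbad; have := ark_le_sup Mgood; rewrite !arkE.
have := chain_bad_total N0; have := chain_good_total N0; rewrite -/I.
set g := total_rank _ _; set b := total_rank _ _ => gN bN.
(* The quadratic terms cancel: [b.*2] is N^2 + 5N + 2 and [g] is N^2 + N + 2. *)
have gb : (b.*2 = g + 4 * N)%N by nia.
have {gb gN bN} gbR : b%:R * 2 = g%:R + 4 * N%:R :> R.
  by rewrite -!natrM -natrD muln2 gb.
rewrite ler_pdivrMr // ler_pdivlMr // => gs ib.
rewrite ler_pdivlMr; last lra.
set s := sup _ in gs *; set i := inf _ in ib infn *.
have nE : N.+1%:R = N%:R + 1 :> R by rewrite -natr1.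
have e0 : 0 < e by rewrite -(@pmulr_lgt0 _ N%:R) ?ltr0n //; lra.
rewrite -(ler_pM2r n0).
(* The gap between twice the bad average and the good one is 4N / (N + 1) < 4. As [i * 2] is at
   least N + 1, the hypothesis [8 <= e * N%:R] yields [e * i >= 4], which absorbs it. *)
have ei : e * N%:R <= e * (i * 2) by rewrite ler_pM2l //; lra.
have : 8 * N.+1%:R <= e * (i * 2) * N.+1%:R by rewrite ler_pM2r //; lra.
lra.
Qed.

End Price.

Theorem proposition8 (R : realType) :
  price_of_dynamics single_peaked (@ark R) (@full_coverage R) = (2%:R)%:E.
Proof.
apply/eqP; rewrite eq_le; apply/andP; split.
  apply: ge_ereal_sup => _ [n [I [M [M' [_ _ _ ->]]]]].
  by rewrite lee_fin; apply: ark_ratio_le.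
apply/lee_subgt0Pr => e e0.
(* The Archimedean bound gives N > 8 / e; the successor ensures N > 0. *)
pose N := (Num.bound (8 / e)).+1.
have eN : 8 <= e * N%:R.
  rewrite mulrC -ler_pdivrMr // ltW // (lt_trans (archi_boundP _)) ?ltr_nat //.
  by rewrite divr_ge0 // ltW.
have bad_bounds n : (1 < n)%N -> (0 < n.-1 < n)%N by lia.
have good_bounds n : (1 < n)%N -> (0 < 1 < n)%N by [].
pose M := round_robin_dynamics R bad_bounds.
pose M' := round_robin_dynamics R good_bounds.
pose I := chain_market N.
have ratio : 2 - e <= sup [set ark R I pi | pi in outcomes M' I]%classic /
                      inf [set ark R I pi | pi in outcomes M I]%classic.
  apply: chain_ratio_ge => //; apply: round_robin_outcome.
    exact: chain_bad_stable.
  exact: chain_good_stable.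
apply: (le_trans (y := _%:E)); first by rewrite -EFinB lee_fin; apply: ratio.
apply: ereal_sup_ubound; exists N.+1, I, M, M'; split=> //.
- exact: chain_single_peaked.
- exact: round_robin_full_coverage.
- exact: round_robin_full_coverage.
Qed.
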